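(* For any $x\in[0,1]$ and any integers $n\ge 1$ and $k\in\{0,1,\ldots,n\}$, the sum $$\sum_{i=0}^{k}\left(x-\frac{i}{n}\right)p_{n,i}^{x,1-x,c}$$ is a non-decreasing function of the real variable $c\ge-\frac{1}{n-1}\min\{x,1-x\}$ (for $n=1$ the lower bound on $c$ is understood as no restriction). Moreover, for $x\in(0,1)$, $n\ge 2$ and $k\in\{0,\ldots,n-1\}$, the sum $\sum_{i=0}^{k}\left(x-\frac{i}{n}\right)p_{n,i}^{x,1-x,c}$ is (strictly) increasing with respect to $c\ge-\frac{1}{n-1}\min\{x,1-x\}$.
   Context: For $y,h\in\mathbb{R}$ and an integer $m\ge 0$, the generalized rising factorial with increment $h$ is $y^{(m,h)}=y(y+h)(y+2h)\cdots(y+(m-1)h)$, with $y^{(0,h)}=1$ (empty product). For an integer $n\ge 1$, $x\in[0,1]$ and a real $c$ satisfying the compatibility condition $x+(n-1)c\ge 0$ and $1-x+(n-1)c\ge 0$ (for $n\ge 2$ this means $c\ge-\frac{1}{n-1}\min\{x,1-x\}$; for $n=1$ every real $c$ is allowed), the Pólya urn probabilities are $$p_{n,i}^{x,1-x,c}=\binom{n}{i}\frac{x^{(i,c)}\,(1-x)^{(n-i,c)}}{1^{(n,c)}},\qquad i\in\{0,1,\ldots,n\}.$$ *)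

(* Defs.v *)
From mathcomp Require Import all_boot all_order all_algebra.
From mathcomp Require Import reals.

Set Implicit Arguments.
Unset Strict Implicit.
Unset Printing Implicit Defensive.

Import Order.TTheory GRing.Theory Num.Theory.
Local Open Scope ring_scope.

(* y^(m,h) = y (y + h) ... (y + (m - 1) h). *)
Definition rising_fact (R : realType) (y : R) (m : nat) (h : R) : R :=
  \prod_(j < m) (y + j%:R * h).

(* p_{n,i}^{x,1-x,c}, meaningful for i <= n (n - i is truncated otherwise). *)
Definition polya_prob (R : realType) (n i : nat) (x c : R) : R :=
  'C(n, i)%:R * (rising_fact x i c * rising_fact (1 - x) (n - i) c
                 / rising_fact 1 n c).

Definition polya_sum (R : realType) (n k : nat) (x c : R) : R :=
  \sum_(i < k.+1) (x - i%:R / n%:R) * polya_prob n i x c.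

(* The values of c with c >= - min(x, 1 - x) / (n - 1). The case n = 1 is
   separated because division by 0 yields 0 here, which would wrongly impose
   c >= 0 instead of no restriction. *)
Definition polya_range (R : realType) (n : nat) (x : R) : {pred R} :=
  [pred c | (n == 1%N) || (- (Num.min x (1 - x) / n.-1%:R) <= c)].

Lemma polya_rangeE (R : realType) (n : nat) (x c : R) :
  (0 < n)%N -> 0 <= x <= 1 ->
  (c \in polya_range n x) =
  (0 <= x + n.-1%:R * c) && (0 <= 1 - x + n.-1%:R * c).
Proof.
case: n => [//|[|n]] _ /andP[x0 x1]; rewrite unfold_in /=.
  by rewrite !mul0r !addr0 x0 subr_ge0 x1.
have n0 : 0 < n.+1%:R :> R by rewrite ltr0n.
rewrite lerNl ler_pdivlMr // le_min mulNr mulrC.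
by rewrite -[_ <= x]subr_ge0 -[_ <= 1 - x]subr_ge0 !opprK.
Qed.

(* Main.v *)
Require Import Defs.
From mathcomp Require Import all_boot all_order all_algebra.
From mathcomp Require Import reals.
From mathcomp Require Import ring lra zify.

Set Implicit Arguments.
Unset Strict Implicit.
Unset Printing Implicit Defensive.

Import Order.TTheory GRing.Theory Num.Theory.
Local Open Scope ring_scope.

(** The partial sums telescope:
    [sum_(i <= k) (x - i/n) p_i = C(n-1,k) x^(k+1,c) (1-x)^(n-k,c) / 1^(n,c)].
    After removing the constant [C(n-1,k) x (1-x)], what is left is the quotient
    of [(x+c)...(x+ac) (1-x+c)...(1-x+bc)] by [(1+c)...(1+(a+b)c)], with [a = k]
    and [b = n-1-k]. A single quotient [(x+jc)/(1+mc)] is non-decreasing in [c]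
    as soon as [m x <= j]. Since [(a+b)x + (a+b)(1-x) = a+b], either
    [(a+b)x <= a] or [(a+b)(1-x) <= b], so one of the two last factors of the
    numerator can be paired with the last factor of the denominator, and one
    concludes by induction on [a+b]. *)

Lemma shiftE (R : realType) (y h : R) (j : nat) :
  y + h + j%:R * h = y + j.+1%:R * h.
Proof. by rewrite -natr1; ring. Qed.

Lemma rising_factS (R : realType) (y : R) (m : nat) (h : R) :
  rising_fact y m.+1 h = rising_fact y m h * (y + m%:R * h).
Proof. by rewrite /rising_fact big_ord_recr. Qed.

Lemma rising_factSl (R : realType) (y : R) (m : nat) (h : R) :
  rising_fact y m.+1 h = y * rising_fact (y + h) m h.
Proof.
rewrite /rising_fact big_ord_recl mul0r addr0; congr (_ * _).
by apply: eq_bigr => j _; rewrite lift0 shiftE.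
Qed.

(** Induction on k. With the common rising factorials removed and both binomials reduced to
    C(n+1,k+1), the step reads (k+1)(1-x+(n-k)c) + (n+1)x - (k+1) = (n-k)(x+(k+1)c). *)
Lemma polya_sum_telescope (R : realType) (n k : nat) (x c : R) : (k <= n)%N ->
  polya_sum n.+1 k x c =
  'C(n, k)%:R * (rising_fact x k.+1 c * rising_fact (1 - x) (n.+1 - k) c
                 / rising_fact 1 n.+1 c).
Proof.
have n0 : n.+1%:R != 0 :> R by rewrite pnatr_eq0.
elim: k => [|k IHk] kn; rewrite /polya_sum big_ord_recr /=.
  by rewrite big_ord0 /polya_prob !bin0 subn0 (rising_factS x 0) !mul0r; ring.
rewrite -/(polya_sum n.+1 k x c) IHk 1?ltnW // /polya_prob subSS.
have binl : n.+1%:R * 'C(n, k)%:R = k.+1%:R * 'C(n.+1, k.+1)%:R :> R.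
  by rewrite -!natrM mul_bin_diag.
have binr : n.+1%:R * 'C(n, k.+1)%:R = (n%:R - k%:R) * 'C(n.+1, k.+1)%:R :> R.
  by rewrite -natrB 1?ltnW // -!natrM (mul_bin_down n.+1 k.+1).
rewrite subSn 1?ltnW // (rising_factS x k.+1) (rising_factS (1 - x)).
rewrite natrB 1?ltnW //.
have -> : 'C(n, k)%:R = k.+1%:R * 'C(n.+1, k.+1)%:R / n.+1%:R :> R.
  by rewrite -binl mulrAC divff // mul1r.
have -> : 'C(n, k.+1)%:R = (n%:R - k%:R) * 'C(n.+1, k.+1)%:R / n.+1%:R :> R.
  by rewrite -binr mulrAC divff // mul1r.
move: (rising_fact 1 n.+1 c)^-1 => D.
move: n0; rewrite -!natr1 => n0; by field.
Qed.

Definition urn_ratio (R : realType) (x : R) (a b : nat) (c : R) : R :=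
  rising_fact (x + c) a c * rising_fact (1 - x + c) b c
  / rising_fact (1 + c) (a + b) c.

Lemma polya_sumE (R : realType) (n k : nat) (x c : R) : (k <= n)%N ->
  polya_sum n.+1 k x c =
  'C(n, k)%:R * (x * (1 - x)) * urn_ratio x k (n - k) c.
Proof.
move=> kn; rewrite polya_sum_telescope // subSn // !rising_factSl /urn_ratio.
by rewrite subnKC // mul1r; ring.
Qed.

(** The last term has weight x - 1 and cancels the telescoped sum up to n, in which (1-x)^(1,c) = 1
    - x. *)
Lemma polya_sum_full (R : realType) (n : nat) (x c : R) :
  polya_sum n.+1 n.+1 x c = 0.
Proof.
rewrite /polya_sum big_ord_recr /= -/(polya_sum n.+1 n x c).
rewrite polya_sum_telescope // /polya_prob subnn subSn // subnn !binn.
rewrite (rising_factS (1 - x)) rising_factS /rising_fact !big_ord0 divff ?pnatr_eq0 //.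
ring.
Qed.

Lemma urn_ratioC (R : realType) (x : R) (a b : nat) (c : R) :
  urn_ratio (1 - x) b a c = urn_ratio x a b c.
Proof. by rewrite /urn_ratio opprB addrCA subrr addr0 addnC; congr (_ / _); ring. Qed.

Lemma urn_ratio00 (R : realType) (x c : R) : urn_ratio x 0 0 c = 1.
Proof. by rewrite /urn_ratio /rising_fact !big_ord0 mul1r divr1. Qed.

Lemma urn_ratioS (R : realType) (x : R) (a b : nat) (c : R) :
  urn_ratio x a.+1 b c =
  urn_ratio x a b c * ((x + a.+1%:R * c) / (1 + (a + b).+1%:R * c)).
Proof.
by rewrite /urn_ratio addSn !rising_factS !shiftE invfM; ring.
Qed.

(** The choice of the factor to pair, made once for both the weak and the strict inequality. [P]
    takes x as an argument because exchanging the colours replaces it by 1 - x. *)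
Lemma urn_ind (R : realType) (P : R -> nat -> nat -> Prop) :
  (forall x, P x 0%N 0%N) ->
  (forall x a b, P (1 - x) b a -> P x a b) ->
  (forall x a b, 0 <= x <= 1 -> (a + b).+1%:R * x <= a.+1%:R ->
     P x a b -> P x a.+1 b) ->
  forall x a b, 0 <= x <= 1 -> P x a b.
Proof.
move=> P0 PC PS x a b; move sE : (a + b)%N => s.
elim: s x a b sE => [|s IHs] x a b sE x01.
  by move: sE => /eqP; rewrite addn_eq0 => /andP[/eqP-> /eqP->].
have step y i j : 0 <= y <= 1 -> (i + j)%N = s.+1 -> (0 < i)%N ->
    s.+1%:R * y <= i%:R -> P y i j.
  case: i => // i y01 [ijs] _ le_i; apply: PS; rewrite ?ijs //.
  exact: IHs.
have abR : a%:R + b%:R = s.+1%:R :> R by rewrite -natrD sE.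
have C01 : 0 <= 1 - x <= 1 by lra.
have [a0|a0] := posnP a.
  apply/PC/step => //; first by rewrite addnC.
    by rewrite a0 in sE; rewrite -[b]add0n sE.
  by rewrite -abR a0 add0r ler_piMr // ?ler0n; lra.
have [le_a|lt_a] := lerP (s.+1%:R * x) a%:R; first exact: step.
apply/PC/step => //; first by rewrite addnC.
  (* Since x <= 1, the inequality a < (a + b) x forces b > 0. *)
  rewrite -(ltr0n R).
  have : s.+1%:R * x <= s.+1%:R :> R by rewrite ler_piMr //; lra.
  by lra.
by rewrite mulrBr mulr1; lra.
Qed.

Section Admissible.
Variables (R : realType) (N : nat).

(** The form that [polya_rangeE] gives to the range, with N the sample size minus one. N stays fixed
    while a + b decreases in the induction. *)
Definition admissible (x c : R) : bool :=
  (0 <= x + N%:R * c) && (0 <= 1 - x + N%:R * c).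

Lemma admissibleC x c : admissible (1 - x) c = admissible x c.
Proof. by rewrite /admissible opprB addrCA subrr addr0 andbC. Qed.

(** For c < 0 the worst case is j = N. *)
Lemma admissible_ge0 x c j : 0 <= x -> (j <= N)%N -> admissible x c ->
  0 <= x + j%:R * c.
Proof.
move=> x0 jN /andP[xN _]; have [c0|c0] := lerP 0 c.
  by rewrite addr_ge0 // mulr_ge0.
by apply: le_trans xN _; rewrite lerD2l ler_nM2r // ler_nat.
Qed.

Lemma admissible_gt0 x c d j : 0 < x -> (j <= N)%N -> admissible x c ->
  c < d -> 0 < x + j%:R * d.
Proof.
case: j => [|j] x0 jN adm cd; first by rewrite mul0r addr0.
apply: le_lt_trans (admissible_ge0 (ltW x0) jN adm) _.
by rewrite ltrD2l ltr_pM2l // ltr0n.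
Qed.

(** The two conditions add up to 1 + 2Nc >= 0, hence 1 + Nc >= 1/2. *)
Lemma admissible_den_gt0 x c j : (j <= N)%N -> admissible x c ->
  0 < 1 + j%:R * c.
Proof.
move=> jN /andP[xN x'N]; have [c0|c0] := lerP 0 c.
  by rewrite ltr_pwDl // mulr_ge0.
have : N%:R * c <= j%:R * c by rewrite ler_nM2r // ler_nat.
by lra.
Qed.

(** After clearing denominators, the two sides differ by (p - q x)(d - c). *)
Lemma factor_le (x c d p q : R) : 0 < 1 + q * c -> 0 < 1 + q * d ->
  q * x <= p -> c <= d -> (x + p * c) / (1 + q * c) <= (x + p * d) / (1 + q * d).
Proof.
move=> c0 d0 pq cd; rewrite ler_pdivrMr // mulrAC ler_pdivlMr // -subr_ge0.
rewrite [leRHS](_ : _ = (p - q * x) * (d - c)); last by ring.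
by rewrite mulr_ge0 // subr_ge0.
Qed.

Lemma factor_lt (x c d p q : R) : 0 < 1 + q * c -> 0 < 1 + q * d ->
  q * x < p -> c < d -> (x + p * c) / (1 + q * c) < (x + p * d) / (1 + q * d).
Proof.
move=> c0 d0 pq cd; rewrite ltr_pdivrMr // mulrAC ltr_pdivlMr // -subr_gt0.
rewrite [ltRHS](_ : _ = (p - q * x) * (d - c)); last by ring.
by rewrite mulr_gt0 // subr_gt0.
Qed.

Lemma rising_fact_shift_ge0 x c m : 0 <= x -> (m <= N)%N -> admissible x c ->
  0 <= rising_fact (x + c) m c.
Proof.
move=> x0 mN adm; apply: prodr_ge0 => j _.
rewrite shiftE.
by apply: admissible_ge0 => //; apply: leq_trans (ltn_ord j) mN.
Qed.

Lemma urn_ratio_ge0 x a b c : 0 <= x <= 1 -> (a + b <= N)%N ->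
  admissible x c -> 0 <= urn_ratio x a b c.
Proof.
move=> x01 abN adm; rewrite divr_ge0 ?mulr_ge0 //.
- by apply: rising_fact_shift_ge0 => //; [lra | lia].
- by apply: rising_fact_shift_ge0; rewrite ?admissibleC //; [lra | lia].
apply: prodr_ge0 => j _; rewrite shiftE.
apply/ltW/(@admissible_den_gt0 x) => //.
exact: leq_trans (ltn_ord j) abN.
Qed.

Lemma urn_ratio_le x a b c d : 0 <= x <= 1 -> (a + b <= N)%N ->
  admissible x c -> admissible x d -> c <= d ->
  urn_ratio x a b c <= urn_ratio x a b d.
Proof.
move=> x01 + + + cd; move: x a b x01.
apply: urn_ind => [x _ _ _|x a b IH abN ac ad|x a b x01 ax IH abN ac ad].
- by rewrite !urn_ratio00.
- by rewrite -!(urn_ratioC x); apply: IH; rewrite ?admissibleC // addnC.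
have dc := admissible_den_gt0 abN ac; have dd := admissible_den_gt0 abN ad.
have x0 : 0 <= x by lra.
rewrite !urn_ratioS ler_pM //.
- by apply: urn_ratio_ge0 => //; lia.
- by rewrite divr_ge0 ?(ltW dc) // admissible_ge0 //; lia.
- by apply: IH => //; lia.
- exact: factor_le.
Qed.

(* At the left end of the range some factors may vanish at [c], but all of them
   are positive at [d > c]; this is what makes the product strictly monotone. *)
Lemma urn_ratio_lt x a b c d : 0 < x < 1 -> (0 < a + b <= N)%N ->
  admissible x c -> admissible x d -> c < d ->
  urn_ratio x a b c < urn_ratio x a b d.
Proof.
move=> x01 + + + cd; have : 0 <= x <= 1 by lra.
move=> xw; move: x a b xw x01.
apply: urn_ind => [//|x a b IH x01 abN ac ad|x a b _ ax IH x01 abN ac ad].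
  by rewrite -!(urn_ratioC x); apply: IH; rewrite ?admissibleC // 1?addnC //; lra.
have {}abN : ((a + b).+1 <= N)%N by [].
have dc := admissible_den_gt0 abN ac; have dd := admissible_den_gt0 abN ad.
have [x0 xw] : 0 < x /\ 0 <= x <= 1 by lra.
(* The empty ratio is constant, so strictness has to start from the first factor (x + c) / (1 + c),
   where x < 1. *)
have [ab0|ab0] := posnP (a + b).
  move/eqP: ab0; rewrite addn_eq0 => /andP[/eqP a0 /eqP b0].
  subst a b; clear IH.
  by rewrite !urn_ratioS !urn_ratio00 ![1 * (_ / _)]mul1r factor_lt //; lra.
(* The new factor moves first, weakly, and the remaining ratio second, strictly: its multiplier is
   then the factor at d, which is positive, while the factor at c may vanish. *)
rewrite !urn_ratioS; apply: (@le_lt_trans _ _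
    (urn_ratio x a b c * ((x + a.+1%:R * d) / (1 + (a + b).+1%:R * d)))).
  by apply: ler_wpM2l; [apply: urn_ratio_ge0 => //; lia
                       |apply: factor_le => //; exact: ltW].
rewrite ltr_pM2r; first by apply: IH => //; rewrite ab0 ltnW.
by rewrite divr_gt0 // (@admissible_gt0 _ c) //; lia.
Qed.

End Admissible.

Theorem lemma3p2 (R : realType) :
  (forall (x : R) (n k : nat),
     0 <= x <= 1 -> (1 <= n)%N -> (k <= n)%N ->
     {in polya_range n x &, {homo polya_sum n k x : c d / c <= d}})
  /\
  (forall (x : R) (n k : nat),
     0 < x < 1 -> (2 <= n)%N -> (k < n)%N ->
     {in polya_range n x &, {homo polya_sum n k x : c d / c < d}}).
Proof.
split=> x [//|n] k x01 n_gt kn c d.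
  rewrite !polya_rangeE // => ac ad cd.
  move: kn; rewrite leq_eqVlt => /predU1P[->|kn]; first by rewrite !polya_sum_full.
  rewrite !polya_sumE //; apply: ler_wpM2l.
    by rewrite mulr_ge0 // mulr_ge0 //; lra.
  by apply: (@urn_ratio_le _ n) => //; rewrite subnKC.
have xw : 0 <= x <= 1 by lra.
rewrite !polya_rangeE // => ac ad cd.
(* The constant C(n,k) x (1 - x) is positive here, and a sample size of at least 2 gives the ratio
   at least one factor. *)
rewrite !polya_sumE // ltr_pM2l.
  by apply: (@urn_ratio_lt _ n) => //; rewrite subnKC // leqnn andbT.
by rewrite mulr_gt0 ?ltr0n ?bin_gt0 // mulr_gt0 //; lra.
Qed.
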